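(* $\mathbf\Delta_\infty=\mathbf\Delta\cap(\mathcal P_{\infty,\infty}\times\mathcal P_{\infty,\infty})$ is dense in $\mathcal P_{\infty,\infty}\times\mathcal P_{\infty,\infty}$ in the operator norm topology.
   Context: $\mathcal H$ is a separable infinite-dimensional complex Hilbert space, $\mathcal B(\mathcal H)$ the bounded operators, $\mathcal P(\mathcal H)=\{P\in\mathcal B(\mathcal H):P=P^2=P^*\}$ with the norm topology. For a closed subspace $\mathcal S$, $P_{\mathcal S}$ denotes the orthogonal projection onto $\mathcal S$; closed subspaces are identified with their projections. Two closed subspaces $\mathcal S,\mathcal T$ have a common complement if there is a closed subspace $\mathcal Z$ with $\mathcal S\cap\mathcal Z=\mathcal T\cap\mathcal Z=\{0\}$ and $\mathcal S+\mathcal Z=\mathcal T+\mathcal Z=\mathcal H$. $\mathbf\Delta=\{(P_{\mathcal S},P_{\mathcal T})\in\mathcal P(\mathcal H)\times\mathcal P(\mathcal H):\mathcal S,\mathcal T\text{ have a common complement}\}$ and $\mathbf\Gamma=(\mathcal P(\mathcal H)\times\mathcal P(\mathcal H))\setminus\mathbf\Delta$. For $0\le i,j\le\infty$ with $i+j=\infty$, $\mathcal P_{i,j}$ denotes the set of projections of rank $i$ and corank ($=\dim$ of null space) $j$. *)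

(* Defs.v *)
From mathcomp Require Import all_boot all_order all_algebra.
From mathcomp Require Import all_classical all_reals all_analysis.
From mathcomp Require Import complex.
Import Order.TTheory GRing.Theory Num.Theory.
Local Open Scope ring_scope.
Local Open Scope classical_set_scope.

Set Implicit Arguments. Unset Strict Implicit. Unset Printing Implicit Defensive.

Section Hilbert.
Variables (R : realType) (H : completeNormedModType R[i]).

(* ip is an inner product (linear in the first argument, conjugate symmetric)
   inducing the norm of H; H being complete, (H, ip) is a Hilbert space. *)
Definition inner_product (ip : H -> H -> R[i]) : Prop :=
  [/\ forall (a : R[i]) (x y z : H), ip (a *: x + y) z = a * ip x z + ip y z,
      forall x y : H, ip y x = (ip x y)^*
    & forall x : H, ip x x = `|x| ^+ 2].

Definition separable_space : Prop :=
  exists u : nat -> H, closure (range u) = [set: H].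

Definition lin_indep (n : nat) (v : 'I_n -> H) : Prop :=
  forall c : 'I_n -> R[i], \sum_(i < n) c i *: v i = 0 -> forall i, c i = 0.

Definition infinite_dim (S : set H) : Prop :=
  forall n : nat, exists v : 'I_n -> H, (forall i, S (v i)) /\ lin_indep v.

Definition bounded_op (T : H -> H) : Prop :=
  (forall (a : R[i]) (x y : H), T (a *: x + y) = a *: T x + T y) /\
  exists M : R[i], forall x : H, `|T x| <= M * `|x|.

Definition orth_proj (ip : H -> H -> R[i]) (T : H -> H) : Prop :=
  [/\ bounded_op T, forall x, T (T x) = T x & forall x y, ip (T x) y = ip x (T y)].

Definition nullspace (T : H -> H) : set H := T @^-1` [set 0].

Definition proj_inf_inf (ip : H -> H -> R[i]) (T : H -> H) : Prop :=
  [/\ orth_proj ip T, infinite_dim (range T) & infinite_dim (nullspace T)].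

Definition closed_subspace (Z : set H) : Prop :=
  [/\ Z 0, (forall (a : R[i]) x y, Z x -> Z y -> Z (a *: x + y)) & closed Z].

Definition common_complement (S T : set H) : Prop :=
  exists Z : set H,
    [/\ closed_subspace Z,
        S `&` Z `<=` [set 0], T `&` Z `<=` [set 0],
        (forall h : H, exists s z, [/\ S s, Z z & h = s + z])
      & (forall h : H, exists t z, [/\ T t, Z z & h = t + z])].

Definition in_Delta (ip : H -> H -> R[i]) (P Q : H -> H) : Prop :=
  [/\ orth_proj ip P, orth_proj ip Q & common_complement (range P) (range Q)].

(* ||A|| < e for the operator norm ||A|| = inf {M | forall x, |A x| <= M |x|} *)
Definition opnorm_lt (A : H -> H) (e : R[i]) : Prop :=
  exists M : R[i], M < e /\ forall x : H, `|A x| <= M * `|x|.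

End Hilbert.

(* Main.v *)
(* If S ∩ T^⊥ and T ∩ S^⊥ are infinite-dimensional, then S and T have a common complement.
   Indeed, let P be the projection onto S and J a partial isometry from S^⊥ onto S ∩ T^⊥.
   The operator P + J maps H into S, is the identity on S and is isometric on T, so
   the image of the orthogonal complement of T ∩ S^⊥ in T has infinite codimension in S.
   Redefining the operator on T ∩ S^⊥ as an isometry onto the orthogonal complement of this
   image in S makes it a bijection from T onto S; its kernel is then a common complement.

   For arbitrary S and T, choose greedily orthonormal sequences with closed spans A1 in S,
   B1 in T^⊥, A2 in T and B2 in S^⊥, pairwise orthogonal. Rotate S inside A1 + B1 and T inside
   A2 + B2 by the same small angle, of cosine c and sine s. If W1 and W2 are the partial
   isometries from B1 onto A1 and from B2 onto A2 used in the rotations, the invertible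
   operator 1 - (c / s) (W1 + W2) maps the rotated S to a subspace that contains B1 and is
   orthogonal to B2, and the rotated T to one that contains B2 and is orthogonal to B1. By
   the first paragraph these images have a common complement, hence so do the rotated S
   and T.

   Boundedness is never tracked: an operator with an everywhere defined adjoint is linear,
   has a closed kernel and pulls closed subspaces back to closed subspaces. *)

Require Import Defs.
From mathcomp Require Import all_boot all_order all_algebra.
From mathcomp Require Import all_classical all_reals all_analysis.
From mathcomp Require Import complex.
From mathcomp Require Import ring lra.
Import Order.TTheory GRing.Theory Num.Theory.
Import numFieldNormedType.Exports.
Local Open Scope ring_scope.
Local Open Scope classical_set_scope.

Set Implicit Arguments. Unset Strict Implicit. Unset Printing Implicit Defensive.

Lemma dependent_seq (T : Type) (P : seq T -> T -> Prop) :
  (forall l, exists x, P l x) -> exists u : nat -> T, forall n, P (mkseq u n) (u n).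
Proof.
move=> /choice[g hg]; pose L := fix L n := if n is m.+1 then rcons (L m) (g (L m)) else [::].
exists (g \o L) => n; have -> : mkseq (g \o L) n = L n by elim: n => // n IH; rewrite mkseqS IH.
exact: hg.
Qed.

Lemma exists_small_angle (R : rcfType) (e : R) : 0 < e ->
  exists c s : R, [/\ c ^+ 2 + s ^+ 2 = 1, s != 0 & `|s| + `|1 - c| < e].
Proof.
move=> e0; pose s := Num.min (e / 3) 1; pose c := Num.sqrt (1 - s ^+ 2).
have s0 : 0 < s by rewrite lt_min divr_gt0 ?ltr01.
have s1 : s <= 1 by rewrite ge_min lexx orbT.
have se : s <= e / 3 by rewrite ge_min lexx.
have c2 : c ^+ 2 = 1 - s ^+ 2 by rewrite sqr_sqrtr// subr_ge0 expr_le1// ltW.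
have c0 : 0 <= c by exact: sqrtr_ge0.
exists c, s; split; [by rewrite c2 subrK|by rewrite gt_eqF|].
have c1 : c <= 1 by nra.
have cs : 1 - s <= c by rewrite -(@ler_pXn2r _ 2) ?nnegrE ?subr_ge0// c2; nra.
by rewrite gtr0_norm// ger0_norm ?subr_ge0//; lra.
Qed.

Lemma norm_real_complex (R : rcfType) (r : R) : `|r%:C%C| = `|r|%:C%C.
Proof. by rewrite normc_def /= expr0n addr0 sqrtr_sqr. Qed.

(** * Closed subspaces *)

Section NormedSpace.
Variables (R : realType) (H : completeNormedModType R[i]).
Implicit Types (x y : H) (A B : set H).

Lemma cvg_sq_dist_le (u : H ^nat) (a : R ^nat) : a @ \oo --> 0 ->
  (forall m n, `|u m - u n| ^+ 2 <= (a m + a n)%:C%C) -> cvgn u.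
Proof.
move=> a0 ua; apply/cauchy_cvgP/cauchy_ballP => e e0.
have /complex_realP[r eE] := gtr0_real e0.
have r2 : 0 < r ^+ 2 / 2 by rewrite divr_gt0// exprn_gt0// -ltcR -eE.
near_simpl; near=> m n.
rewrite -ball_normE /ball_ /= -(@ltr_pXn2r _ 2) ?nnegrE ?(ltW e0)//.
apply: le_lt_trans (ua m n) _; rewrite eE -rmorphXn ltcR [ltRHS]splitr.
by rewrite ltrD//; [near: m|near: n]; apply: cvgr_lt a0 _ r2.
Unshelve. all: by end_near. Qed.

Lemma cvg0_sq_le (V : normedModType R[i]) (v : V ^nat) (a : R ^nat) : a @ \oo --> 0 ->
  (forall n, `|v n| ^+ 2 <= (a n)%:C%C) -> v @ \oo --> 0.
Proof.
move=> a0 va; apply/cvgr0Pnorm_lt => e e0.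
have /complex_realP[r eE] := gtr0_real e0.
have r2 : 0 < r ^+ 2 by rewrite exprn_gt0// -ltcR -eE.
near=> n; rewrite -(@ltr_pXn2r _ 2) ?nnegrE ?(ltW e0)//.
apply: le_lt_trans (va n) _; rewrite eE -rmorphXn ltcR.
by near: n; apply: cvgr_lt a0 _ r2.
Unshelve. all: by end_near. Qed.

Section ClosedSubspace.
Variables (A : set H) (hA : closed_subspace A).

Lemma closed_subspaceZ a x : A x -> A (a *: x).
Proof. by case: hA => A0 hP _ Ax; have := hP a _ _ Ax A0; rewrite addr0. Qed.

Lemma closed_subspaceD x y : A x -> A y -> A (x + y).
Proof. by case: hA => _ hP _ Ax Ay; have := hP 1 _ _ Ax Ay; rewrite scale1r. Qed.

Lemma closed_subspaceN x : A x -> A (- x).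
Proof. by rewrite -scaleN1r; exact: closed_subspaceZ. Qed.

Lemma closed_subspaceB x y : A x -> A y -> A (x - y).
Proof. by move=> Ax Ay; apply: closed_subspaceD => //; exact: closed_subspaceN. Qed.

Lemma closed_subspace_sum I (r : seq I) (P : pred I) (F : I -> H) :
  (forall i, P i -> A (F i)) -> A (\sum_(i <- r | P i) F i).
Proof.
move=> AF; apply: (big_ind A) => // [|x y]; [by case: hA|exact: closed_subspaceD].
Qed.

End ClosedSubspace.

Lemma closed_subspaceI A B :
  closed_subspace A -> closed_subspace B -> closed_subspace (A `&` B).
Proof.
move=> [A0 AP cA] [B0 BP cB]; split=> //; last exact: closedI.
by move=> a x y [Ax Bx] [Ay By]; split; [exact: AP|exact: BP].
Qed.

Lemma infinite_dimS A B : A `<=` B -> infinite_dim A -> infinite_dim B.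
Proof. by move=> AB iA n; have [v [Av vI]] := iA n; exists v; split=> // i; exact/AB. Qed.

End NormedSpace.

(** * Inner products *)

Section Hilbert.
Variables (R : realType) (H : completeNormedModType R[i]) (ip : H -> H -> R[i]).
Hypothesis hip : inner_product ip.
Local Notation C := R[i].
Implicit Types (x y z : H) (A B : set H) (E F G P : H -> H).

Lemma ipC x y : ip y x = (ip x y)^*.
Proof. by case: hip. Qed.

Lemma ip_norm x : ip x x = `|x| ^+ 2.
Proof. by case: hip. Qed.

Lemma ipDl x y z : ip (x + y) z = ip x z + ip y z.
Proof. by case: hip => ipP _ _; have := ipP 1 x y z; rewrite scale1r mul1r. Qed.

Lemma ip0l z : ip 0 z = 0.
Proof. by apply: (@addrI _ (ip 0 z)); rewrite -ipDl !addr0. Qed.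

Lemma ipZl a x z : ip (a *: x) z = a * ip x z.
Proof. by case: hip => ipP _ _; have := ipP a x 0 z; rewrite !addr0 ip0l addr0. Qed.

Lemma ipNl x z : ip (- x) z = - ip x z.
Proof. by rewrite -scaleN1r ipZl mulN1r. Qed.

Lemma ipBl x y z : ip (x - y) z = ip x z - ip y z.
Proof. by rewrite ipDl ipNl. Qed.

Lemma ip_suml I (r : seq I) (P : pred I) (F : I -> H) z :
  ip (\sum_(i <- r | P i) F i) z = \sum_(i <- r | P i) ip (F i) z.
Proof. exact: (big_morph (ip^~ z) (fun x y => ipDl x y z) (ip0l z)). Qed.

Lemma ip0r x : ip x 0 = 0.
Proof. by rewrite ipC ip0l rmorph0. Qed.

Lemma ipDr x y z : ip x (y + z) = ip x y + ip x z.
Proof. by rewrite (ipC (y + z)) ipDl rmorphD (ipC y) (ipC z). Qed.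

Lemma ipZr a x y : ip x (a *: y) = a^* * ip x y.
Proof. by rewrite (ipC (a *: y)) ipZl rmorphM (ipC y). Qed.

Lemma ipNr x y : ip x (- y) = - ip x y.
Proof. by rewrite (ipC (- y)) ipNl rmorphN (ipC y). Qed.

Lemma ipBr x y z : ip x (y - z) = ip x y - ip x z.
Proof. by rewrite ipDr ipNr. Qed.

Lemma ip_eq0C x y : ip x y = 0 -> ip y x = 0.
Proof. by move=> xy; rewrite ipC xy rmorph0. Qed.

Lemma ip_self_eq0 x : ip x x = 0 -> x = 0.
Proof. by rewrite ip_norm => /eqP; rewrite sqrf_eq0 normr_eq0 => /eqP. Qed.

Lemma ip_inj x y : (forall z, ip x z = ip y z) -> x = y.
Proof. by move=> xy; apply/subr0_eq/ip_self_eq0; rewrite ipBl xy subrr. Qed.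

Lemma normD_orth x y : ip x y = 0 -> `|x + y| ^+ 2 = `|x| ^+ 2 + `|y| ^+ 2.
Proof.
move=> xy; rewrite -!ip_norm ipDl !ipDr xy (ip_eq0C xy).
by rewrite addr0 add0r.
Qed.

Lemma parallelogram x y : `|x + y| ^+ 2 + `|x - y| ^+ 2 = 2 * (`|x| ^+ 2 + `|y| ^+ 2).
Proof. by rewrite -!ip_norm ipBl ipDl !ipBr !ipDr; ring. Qed.

Lemma norm_sub_proj_line x y : `|x - (ip x y / `|y| ^+ 2) *: y| ^+ 2 * `|y| ^+ 2 =
  `|x| ^+ 2 * `|y| ^+ 2 - `|ip x y| ^+ 2.
Proof.
have [->|y0] := eqVneq y 0; first by rewrite ip0r !normr0 expr0n !mulr0 subr0.
have conj_coef : (ip x y / `|y| ^+ 2)^* = ip y x / `|y| ^+ 2.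
  rewrite (ipC x y) rmorphM fmorphV; congr (_ / _).
  by apply: geC0_conj; exact: exprn_ge0.
rewrite -ip_norm ipBl !ipBr !ipZl !ipZr !ip_norm normCK conj_coef -ipC.
by field; rewrite normr_eq0.
Qed.

Lemma cauchy_schwarz x y : `|ip x y| <= `|x| * `|y|.
Proof.
rewrite -(@ler_pXn2r _ 2) ?nnegrE ?mulr_ge0// exprMn -subr_ge0 -norm_sub_proj_line.
by rewrite mulr_ge0 ?exprn_ge0.
Qed.

Lemma ip_continuous y : continuous (fun x => ip x y : C^o).
Proof.
move=> x; apply/cvgrPdist_lt => e e0; near=> z.
rewrite -ipBl (le_lt_trans (cauchy_schwarz _ _))//.
apply: (@le_lt_trans _ _ (`|x - z| * (`|y| + 1))).
  by rewrite ler_wpM2l// lerDl.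
rewrite -ltr_pdivlMr ?ltr_wpDl//; near: z.
by apply: cvgr_dist_lt; rewrite // divr_gt0 ?ltr_wpDl.
Unshelve. all: by end_near. Qed.

Lemma cvg_ip (u : H ^nat) l y : u @ \oo --> l ->
  (fun n => ip (u n) y : C^o) @ \oo --> (ip l y : C^o).
Proof. by move=> ul; exact: (cvg_comp u (fun x => ip x y : C^o) ul (@ip_continuous y l)). Qed.

Lemma cvg_ipr (u : H ^nat) l y : u @ \oo --> l ->
  (fun n => ip y (u n) : C^o) @ \oo --> (ip y l : C^o).
Proof.
move=> /(cvg_ip (y := y))/cvgrPdist_lt ul; apply/cvgrPdist_lt => e /ul.
apply: filterS => n; apply: le_lt_trans.
by rewrite -ipBr -ipBl (ipC (l - u n)) norm_conjC.
Qed.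

Definition orthc A : set H := [set x | forall a, A a -> ip x a = 0].

Lemma closed_subspace_orthc A : closed_subspace (orthc A).
Proof.
split=> [a _|a x y Ax Ay b Ab|]; first exact: ip0l.
  by rewrite ipDl ipZl Ax// Ay// mulr0 addr0.
have -> : orthc A = \bigcap_(a in A) (fun x => ip x a : C^o) @^-1` [set 0 : C^o] by [].
apply: closed_bigI => a _; apply: preimage_closed => [x _|]; first exact: ip_continuous.
exact/accessible_closed_set1/hausdorff_accessible/norm_hausdorff.
Qed.

Lemma closed_subspaceI_orthc A B : closed_subspace A -> closed_subspace (A `&` orthc B).
Proof. by move=> hA; apply: closed_subspaceI => //; exact: closed_subspace_orthc. Qed.

Lemma sub_orthcC A B : A `<=` orthc B -> B `<=` orthc A.
Proof. by move=> AB b Bb a Aa; apply/ip_eq0C/AB. Qed.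

Lemma orthcS A B : A `<=` B -> orthc B `<=` orthc A.
Proof. by move=> AB x Bx a /AB; exact: Bx. Qed.

Lemma orthc_self_eq0 A x : A x -> orthc A x -> x = 0.
Proof. by move=> Ax /(_ x Ax); exact: ip_self_eq0. Qed.

(** * Orthogonal projections *)

Definition proj_onto (E : H -> H) A := forall x, A (E x) /\ orthc A (x - E x).

Lemma minimizing_sequence A x : closed_subspace A -> exists (d : R) (u : H ^nat),
  [/\ forall n, A (u n), forall a, A a -> d%:C%C <= `|x - a| ^+ 2 &
      forall n, `|x - u n| ^+ 2 <= (d + harmonic n)%:C%C].
Proof.
move=> [A0 _ _]; pose dist2 a := complex.Re (`|x - a| ^+ 2).
have dist2E a : `|x - a| ^+ 2 = (dist2 a)%:C%C.
  by rewrite RRe_real// ger0_real// exprn_ge0.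
pose D := [set dist2 a | a in A].
have hD : has_inf D.
  split; [by exists (dist2 0); exists 0|exists 0 => _ [a _ <-]].
  by rewrite -ler0c -dist2E exprn_ge0.
have /choice[u hu] : forall n, exists a, A a /\ dist2 a < inf D + harmonic n.
  by move=> n; have [_ [a Aa <-] h] := inf_adherent (harmonic_gt0 n) hD; exists a.
exists (inf D), u; split=> [n|a Aa|n]; first exact: (hu n).1.
  by rewrite dist2E lecR; apply: ge_inf; [exact: hD.2|exists a].
by rewrite dist2E lecR; exact/ltW/(hu n).2.
Qed.

Section DistanceLowerBound.
Variables (A : set H) (x : H) (d : R).
Hypotheses (hA : closed_subspace A) (dA : forall a, A a -> d%:C%C <= `|x - a| ^+ 2).

Lemma near_minimizers_close a b : A a -> A b ->
  `|a - b| ^+ 2 <= 2 * ((`|x - a| ^+ 2 - d%:C%C) + (`|x - b| ^+ 2 - d%:C%C)).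
Proof.
move=> Aa Ab; pose m := 2^-1 *: (a + b).
have xab : (x - a) + (x - b) = 2 *: (x - m).
  rewrite scalerBr scalerA divff ?pnatr_eq0// scale1r scaler_nat mulr2n.
  by rewrite opprD addrACA.
have ab : (x - a) - (x - b) = b - a by rewrite opprB addrC addrA subrK.
have := parallelogram (x - a) (x - b); rewrite xab ab normrZ exprMn => xabE.
rewrite distrC -subr_ge0.
have -> : 2 * (`|x - a| ^+ 2 - d%:C%C + (`|x - b| ^+ 2 - d%:C%C)) - `|b - a| ^+ 2 =
    4 * (`|x - m| ^+ 2 - d%:C%C).
  rewrite -addrACA mulrDr -xabE normr_nat; ring.
rewrite mulr_ge0// subr_ge0 dA//; apply: closed_subspaceZ => //.
exact: closed_subspaceD.
Qed.

Lemma near_minimizer_orth a b : A a -> A b ->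
  `|ip (x - a) b| ^+ 2 <= (`|x - a| ^+ 2 - d%:C%C) * `|b| ^+ 2.
Proof.
move=> Aa Ab; pose c := ip (x - a) b / `|b| ^+ 2.
have -> : `|ip (x - a) b| ^+ 2 = (`|x - a| ^+ 2 - `|x - (a + c *: b)| ^+ 2) * `|b| ^+ 2.
  by rewrite opprD addrA mulrBl norm_sub_proj_line subKr.
rewrite ler_wpM2r ?exprn_ge0// lerD2l lerN2 dA//.
by apply: closed_subspaceD => //; exact: closed_subspaceZ.
Qed.

End DistanceLowerBound.

Lemma orth_decomp A x : closed_subspace A -> exists a, A a /\ orthc A (x - a).
Proof.
move=> hA; have [d [u [Au dA ud]]] := minimizing_sequence x hA.
have {}ud n : `|x - u n| ^+ 2 - d%:C%C <= (harmonic n)%:C%C by rewrite lerBlDl -rmorphD.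
have cvgM_harmonic (c : R) : (fun n => c * harmonic n) @ \oo --> 0.
  by rewrite -(mulr0 c); apply: cvgM; [exact: cvg_cst|exact: cvg_harmonic].
have /cvg_ex[l ul] : cvgn u.
  apply: (cvg_sq_dist_le (cvgM_harmonic 2)) => m n.
  apply: le_trans (near_minimizers_close hA dA (Au m) (Au n)) _.
  by rewrite -mulrDr !mulr_natl rmorphMn rmorphD ler_wMn2r// lerD.
exists l; split=> [|b Ab].
  by case: hA => _ _ cA; apply: (closed_cvg _ cA _ _ ul); exact: nearW.
have xub : (fun n => ip (x - u n) b : C^o) @ \oo --> (ip (x - l) b : C^o).
  by apply: cvg_ip; apply: cvgB ul; exact: cvg_cst.
apply: (cvg_unique (@norm_hausdorff _ _) xub).
have /complex_realP[r bE] : `|b| ^+ 2 \is Num.real by rewrite realX ?normr_real.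
apply: (@cvg0_sq_le _ C^o _ _ (cvgM_harmonic r)) => n.
apply: le_trans (near_minimizer_orth hA dA (Au n) Ab) _.
by rewrite bE mulrC rmorphM ler_wpM2l// -bE exprn_ge0.
Qed.

Lemma proj_exists A : closed_subspace A -> exists E, proj_onto E A.
Proof. by move=> hA; have /choice[E hE] := fun x => orth_decomp x hA; exists E. Qed.

Lemma orthcK A : closed_subspace A -> orthc (orthc A) = A.
Proof.
move=> hA; apply/seteqP; split=> [x Ax|]; last exact: sub_orthcC.
have [a [Aa xa]] := orth_decomp x hA; have AaC : orthc (orthc A) a by exact: sub_orthcC Aa.
suff -> : x = a by [].
apply/subr0_eq/(orthc_self_eq0 xa).
exact: (closed_subspaceB (closed_subspace_orthc _) Ax AaC).
Qed.

(** * Operators with an adjoint *)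

Definition adjoint (F F' : H -> H) := forall x y, ip (F x) y = ip x (F' y).

Lemma adjoint_sym F F' : adjoint F F' -> adjoint F' F.
Proof. by move=> aF x y; rewrite (ipC y) -aF -ipC. Qed.

Lemma adjoint_add F F' G G' : adjoint F F' -> adjoint G G' ->
  adjoint (fun x => F x + G x) (fun x => F' x + G' x).
Proof. by move=> aF aG x y; rewrite ipDl ipDr aF aG. Qed.

Lemma adjoint_sub F F' G G' : adjoint F F' -> adjoint G G' ->
  adjoint (fun x => F x - G x) (fun x => F' x - G' x).
Proof. by move=> aF aG x y; rewrite ipBl ipBr aF aG. Qed.

Lemma adjoint_scale (c : R) F F' : adjoint F F' ->
  adjoint (fun x => c%:C%C *: F x) (fun x => c%:C%C *: F' x).
Proof.
move=> aF x y; rewrite ipZl ipZr aF; congr (_ * _).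
by rewrite conj_Creal//; apply/complex_realP; exists c.
Qed.

Lemma adjoint_comp F F' G G' : adjoint F F' -> adjoint G G' ->
  adjoint (fun x => F (G x)) (fun x => G' (F' x)).
Proof. by move=> aF aG x y; rewrite aF aG. Qed.

Lemma adjoint_id : adjoint id id.
Proof. by []. Qed.

Section AdjointableOperator.
Variables F F' : H -> H.
Hypothesis aF : adjoint F F'.

Lemma adjoint_op0 : F 0 = 0.
Proof. by apply: ip_inj => z; rewrite aF !ip0l. Qed.

Lemma adjoint_opD x y : F (x + y) = F x + F y.
Proof. by apply: ip_inj => z; rewrite ipDl !aF ipDl. Qed.

Lemma adjoint_opZ a x : F (a *: x) = a *: F x.
Proof. by apply: ip_inj => z; rewrite ipZl !aF ipZl. Qed.

Lemma adjoint_opN x : F (- x) = - F x.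
Proof. by rewrite -scaleN1r adjoint_opZ scaleN1r. Qed.

Lemma adjoint_opB x y : F (x - y) = F x - F y.
Proof. by rewrite adjoint_opD adjoint_opN. Qed.

Lemma adjoint_op_sum n (c : 'I_n -> C) (v : 'I_n -> H) :
  F (\sum_(i < n) c i *: v i) = \sum_(i < n) c i *: F (v i).
Proof.
by apply: ip_inj => z; rewrite aF !ip_suml; apply: eq_bigr => i _; rewrite !ipZl aF.
Qed.

Lemma closed_subspace_ker : closed_subspace [set x | F x = 0].
Proof.
have -> : [set x | F x = 0] = orthc (range F'); last exact: closed_subspace_orthc.
apply/seteqP; split=> [x Fx _ [y _ <-]|x xF']; first by rewrite -aF Fx ip0l.
by apply: ip_inj => z; rewrite ip0l aF; apply: xF'; exists z.
Qed.

Lemma closed_subspace_preimage A : closed_subspace A -> closed_subspace (F @^-1` A).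
Proof.
move=> /orthcK {1}<-; have -> : F @^-1` orthc (orthc A) = orthc (F' @` orthc A).
  apply/seteqP; split=> [x Fx _ [y Ay <-]|x xF' y Ay]; first by rewrite -aF Fx.
  by rewrite aF; apply: xF'; exists y.
exact: closed_subspace_orthc.
Qed.

Lemma infinite_dim_image A B : closed_subspace A -> (forall x, A x -> B (F x)) ->
  (forall x, A x -> F x = 0 -> x = 0) -> infinite_dim A -> infinite_dim B.
Proof.
move=> hA AB injF iA n; have [v [Av vI]] := iA n.
exists (F \o v); split=> [i|c]; first exact: AB.
rewrite -adjoint_op_sum => /injF Fv0; apply: vI; apply: Fv0.
by apply: closed_subspace_sum => // i _; exact: closed_subspaceZ.
Qed.

Lemma proj_onto_image E A : proj_onto E A ->
  (forall a b, A a -> A b -> ip (F a) (F b) = ip a b) ->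
  proj_onto (fun y => F (E (F' y))) (F @` A).
Proof.
move=> hE isoF y; have [AE oE] := hE (F' y); split; first by exists (E (F' y)).
by move=> _ [a Aa <-]; rewrite ipBl isoF// -(adjoint_sym aF) -ipBl oE.
Qed.

End AdjointableOperator.

Section Projection.
Variables (A : set H) (E : H -> H).
Hypotheses (hA : closed_subspace A) (hE : proj_onto E A).

Lemma proj_in x : A (E x).
Proof. exact: (hE x).1. Qed.

Lemma proj_orthc x : orthc A (x - E x).
Proof. exact: (hE x).2. Qed.

Lemma proj_unique x a : A a -> orthc A (x - a) -> E x = a.
Proof.
move=> Aa xa; apply/subr0_eq/(@orthc_self_eq0 A).
  exact: (closed_subspaceB hA (proj_in x) Aa).
have -> : E x - a = (x - a) - (x - E x) by rewrite opprB [RHS]addrC addrA subrK.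
exact: (closed_subspaceB (closed_subspace_orthc A) xa (proj_orthc x)).
Qed.

Lemma proj_id a : A a -> E a = a.
Proof. by move=> Aa; apply: proj_unique => // b _; rewrite subrr ip0l. Qed.

Lemma proj_eq0 x : orthc A x -> E x = 0.
Proof. by move=> Ax; apply: proj_unique; [case: hA|rewrite subr0]. Qed.

Lemma proj_adjoint : adjoint E E.
Proof.
move=> x y; transitivity (ip (E x) (E y)); apply/eqP; rewrite -subr_eq0.
  by rewrite -ipBr (ip_eq0C (proj_orthc y (proj_in x))).
by rewrite -ipBl -opprB ipNl proj_orthc ?oppr0//; exact: proj_in.
Qed.

Lemma norm_proj_le x : `|E x| <= `|x|.
Proof.
rewrite -(@ler_pXn2r _ 2) ?nnegrE// -[in leRHS](subrK (E x) x).
by rewrite normD_orth ?lerDr ?exprn_ge0//; apply: proj_orthc; exact: proj_in.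
Qed.

Lemma proj_onto_orth_proj : orth_proj ip E.
Proof.
split; [split|by move=> x; exact/proj_id/proj_in|exact: proj_adjoint].
  by move=> a x y; rewrite (adjoint_opD proj_adjoint) (adjoint_opZ proj_adjoint).
by exists 1 => x; rewrite mul1r norm_proj_le.
Qed.

Lemma range_proj : range E = A.
Proof.
apply/seteqP; split=> [_ [x _ <-]|a Aa]; first exact: proj_in.
by exists a => //; exact: proj_id.
Qed.

Lemma nullspace_proj : nullspace E = orthc A.
Proof.
apply/seteqP; split=> [x Ex|x]; last exact: proj_eq0.
by rewrite -[x]subr0 -Ex; exact: proj_orthc.
Qed.

End Projection.

Lemma orth_proj_onto P : orth_proj ip P -> closed_subspace (range P) /\ proj_onto P (range P).
Proof.
move=> [_ PP aP]; split; last first.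
  by move=> x; split=> [|_ [y _ <-]]; [exists x|rewrite -aP (adjoint_opB aP) PP subrr ip0l].
have -> : range P = [set x | x - P x = 0].
  apply/seteqP; split=> [_ [x _ <-]|x /subr0_eq xP]; first by rewrite /= PP subrr.
  by exists x.
exact: closed_subspace_ker (adjoint_sub adjoint_id aP).
Qed.

(** * Orthonormal sequences and partial isometries *)

Definition orthonormal_family (I : eqType) (e : I -> H) :=
  forall i j, ip (e i) (e j) = (i == j)%:R.

Definition cspan (e : nat -> H) := orthc (orthc (range e)).

Lemma cspan_sub A (e : nat -> H) :
  closed_subspace A -> (forall n, A (e n)) -> cspan e `<=` A.
Proof.
by move=> hA Ae; rewrite -(orthcK hA); apply/orthcS/orthcS => _ [n _ <-].
Qed.

Lemma cspan_orthc (e g : nat -> H) :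
  (forall m n, ip (e m) (g n) = 0) -> cspan e `<=` orthc (cspan g).
Proof.
move=> eg; apply: cspan_sub => [|m]; first exact: closed_subspace_orthc.
by move=> z gz; apply/ip_eq0C/gz => _ [n _ <-].
Qed.

Lemma orthonormal_infinite_dim A (e : nat -> H) :
  orthonormal_family e -> (forall n, A (e n)) -> infinite_dim A.
Proof.
move=> oe Ae n; exists (fun i => e i); split=> // c c0 i.
have := ip0l (e i); rewrite -c0 ip_suml (bigD1 i)//= ipZl oe eqxx mulr1.
by rewrite big1 ?addr0// => j ji; rewrite ipZl oe (inj_eq val_inj) (negbTE ji) mulr0.
Qed.

Lemma infinite_dim_cspan (e : nat -> H) : orthonormal_family e -> infinite_dim (cspan e).
Proof.
move=> oe; apply: (orthonormal_infinite_dim oe) => n.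
by move=> z ez; apply/ip_eq0C/ez; exists n.
Qed.

Lemma orthonormal_dependent_seq (P : seq H -> H -> Prop) :
  (forall l, exists x, [/\ P l x, `|x| = 1 & forall y, y \in l -> ip x y = 0]) ->
  exists e : nat -> H, orthonormal_family e /\ forall n, P (mkseq e n) (e n).
Proof.
move=> /dependent_seq[e he]; exists e; split=> [n m|n]; last by case: (he n).
have orth_lt i j : (j < i)%N -> ip (e i) (e j) = 0.
  by move=> ji; case: (he i) => _ _; apply; apply/mapP; exists j; rewrite ?mem_iota.
case: ltngtP => [nm|mn|->]; [exact/ip_eq0C/orth_lt|exact: orth_lt|].
by rewrite ip_norm; case: (he m) => _ -> _; rewrite expr1n.
Qed.

Lemma exists_unit_orth A (l : seq H) : closed_subspace A -> infinite_dim A ->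
  exists x, [/\ A x, `|x| = 1 & forall y, y \in l -> ip x y = 0].
Proof.
move=> hA /(_ (size l).+1)[v [Av vI]].
pose M : 'M[C]_((size l).+1, size l) := \matrix_(i, j) ip (v i) (nth 0 l j).
have : kermx M != 0.
  rewrite kermx_eq0 /row_free; apply/negP => /eqP rM.
  by have := rank_leq_col M; rewrite rM ltnn.
case/rowV0Pn => c /sub_kermxP cM c0; pose x := \sum_i c 0 i *: v i.
have Ax : A x by apply: closed_subspace_sum => // i _; exact: closed_subspaceZ.
have x0 : x != 0.
  by apply: contra_neq c0 => /vI c0; apply/rowP => i; rewrite c0 mxE.
exists (`|x|^-1 *: x); split; [exact: closed_subspaceZ|exact: normfZV|].
move=> _ /(nthP 0)[j jl <-]; rewrite ipZl ip_suml.
have -> : \sum_i ip (c 0 i *: v i) (nth 0 l j) = (c *m M) 0 (Ordinal jl).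
  by rewrite mxE; apply: eq_bigr => i _; rewrite ipZl mxE.
by rewrite cM mxE mulr0.
Qed.

Lemma orthonormal_selection (I : countType) (A : I -> set H) : infinite_dim [set: H] ->
  (forall i, closed_subspace (A i)) -> (forall i, infinite_dim (A i)) ->
  exists e : I -> H, orthonormal_family e /\ forall i, A i (e i).
Proof.
move=> iH hA iA.
have hT : closed_subspace [set: H] by split=> //; exact: closedT.
have [l|u [ou Au]] := @orthonormal_dependent_seq
    (fun l x => if unpickle (size l) is Some i then A i x else [set: H] x).
  by case: unpickle => [i|]; exact: exists_unit_orth.
exists (u \o pickle); split=> [i j|i]; first by rewrite ou (inj_eq (pcan_inj pickleK)).
by have := Au (pickle i); rewrite size_mkseq pickleK.
Qed.

Lemma exists_unit_orth_capturing A (l : seq H) y : closed_subspace A -> infinite_dim A ->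
  exists x, [/\ A x, `|x| = 1, forall w, w \in l -> ip x w = 0 & forall z, A z ->
    (forall w, w \in l -> ip z w = 0) -> ip z x = 0 -> ip z y = 0].
Proof.
move=> hA iA; pose Al := A `&` orthc [set` l].
have hAl : closed_subspace Al by exact: closed_subspaceI_orthc.
have [E hE] := proj_exists hAl; have [AEy lEy] := proj_in hE y.
have yE z : A z -> (forall w, w \in l -> ip z w = 0) -> ip z y = ip z (E y).
  by move=> Az zl; rewrite -(proj_adjoint hE) (proj_id hAl hE).
have [Ey0|Ey0] := eqVneq (E y) 0.
  have [x [Ax x1 xl]] := exists_unit_orth l hA iA; exists x; split=> // z Az zl _.
  by rewrite yE// Ey0 ip0r.
exists (`|E y|^-1 *: E y); split.
- exact: closed_subspaceZ.
- exact: normfZV.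
- by move=> w lw; rewrite ipZl lEy ?mulr0.
move=> z Az zl /eqP; rewrite ipZr mulf_eq0 conjC_eq0 invr_eq0 normr_eq0 (negbTE Ey0) /=.
by rewrite yE// => /eqP.
Qed.

Lemma orthc_dense_eq0 A z : closure A = [set: H] -> orthc A z -> z = 0.
Proof.
move=> dA Az; have [_ _ /closure_id cz] := closed_subspace_orthc [set z].
apply: (@orthc_self_eq0 [set z]) => //; rewrite cz.
have : closure A z by rewrite dA.
by apply: closureS => a Aa _ ->; exact/ip_eq0C/Az.
Qed.

Lemma orthonormal_basis A : separable_space H -> closed_subspace A -> infinite_dim A ->
  exists e : nat -> H, orthonormal_family e /\ cspan e = A.
Proof.
move=> [u du] hA iA.
have [l|e [oe Pe]] := @orthonormal_dependent_seq (fun l x => A x /\ forall z, A z ->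
    (forall w, w \in l -> ip z w = 0) -> ip z x = 0 -> ip z (u (size l)) = 0).
  have [x [Ax x1 xl xu]] := exists_unit_orth_capturing l (u (size l)) hA iA.
  by exists x.
have eA : cspan e `<=` A by apply: cspan_sub => // n; exact: (Pe n).1.
exists e; split=> //; apply/seteqP; split=> // z Az.
have [E hE] := proj_exists (closed_subspace_orthc (orthc (range e))).
have ez n : ip (z - E z) (e n) = 0.
  have := proj_orthc hE z; rewrite (orthcK (closed_subspace_orthc _)).
  by apply; exists n.
suff -> : z = E z by exact: (proj_in hE z).
apply/subr0_eq/(orthc_dense_eq0 du) => _ [n _ <-].
have := (Pe n).2 (z - E z); rewrite size_mkseq; apply; last exact: ez.
  by apply: closed_subspaceB => //; apply: eA; exact: (proj_in hE z).
by move=> _ /mapP[k _ ->].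
Qed.

Lemma ip_orthonormal_sum (g : nat -> H) (a : nat -> C) m n k : orthonormal_family g ->
  ip (\sum_(m <= j < n) a j *: g j) (g k) = if (m <= k < n)%N then a k else 0.
Proof.
move=> og; rewrite ip_suml; under eq_bigr do rewrite ipZl og.
case: ifPn => mkn.
  rewrite (bigD1_seq k) ?mem_index_iota ?iota_uniq//= eqxx mulr1 big1 ?addr0// => j jk.
  by rewrite (negbTE jk) mulr0.
rewrite big_seq_cond big1// => j /andP[]; rewrite mem_index_iota => mjn _.
by case: eqP => [jk|]; rewrite ?mulr0//; rewrite jk (negbTE mkn) in mjn.
Qed.

Lemma norm_orthonormal_sum (g : nat -> H) (a : nat -> C) m n : orthonormal_family g ->
  `|\sum_(m <= k < n) a k *: g k| ^+ 2 = \sum_(m <= k < n) `|a k| ^+ 2.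
Proof.
move=> og; rewrite -ip_norm {1}ip_suml; apply: eq_big_nat => k mkn.
by rewrite ipZl (ipC (\sum_(m <= j < n) _)) ip_orthonormal_sum// mkn normCK.
Qed.

Lemma bessel (e : nat -> H) x n : orthonormal_family e ->
  \sum_(0 <= k < n) `|ip x (e k)| ^+ 2 <= `|x| ^+ 2.
Proof.
move=> oe; rewrite -(norm_orthonormal_sum (fun k => ip x (e k)) 0 n oe).
set y := \sum_(_ <= _ < _) _.
rewrite -[in leRHS](subrK y x) normD_orth ?lerDr ?exprn_ge0//.
apply: ip_eq0C; rewrite ip_suml big_nat_cond big1// => k /andP[/andP[_ kn] _].
by rewrite ipZl (ipC (x - y)) ipBl ip_orthonormal_sum//= kn subrr rmorph0 mulr0.
Qed.

Definition transfer (e g : nat -> H) x := limn (series (fun k => ip x (e k) *: g k)).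

Section Transfer.
Variables e g : nat -> H.
Hypotheses (oe : orthonormal_family e) (og : orthonormal_family g).

Lemma transfer_cvg x : series (fun k => ip x (e k) *: g k) @ \oo --> transfer e g x.
Proof.
pose c := series (fun k => complex.Re (`|ip x (e k)| ^+ 2)).
have ReE k : (complex.Re (`|ip x (e k)| ^+ 2))%:C%C = `|ip x (e k)| ^+ 2.
  by rewrite RRe_real// ger0_real// exprn_ge0.
have sumE m n : (m <= n)%N ->
    `|series (fun k => ip x (e k) *: g k) n - series (fun k => ip x (e k) *: g k) m| ^+ 2 =
    (c n - c m)%:C%C.
  move=> mn; rewrite !sub_series_geq// norm_orthonormal_sum//.
  by rewrite rmorph_sum (eq_bigr _ (fun k _ => ReE k)).
have c_nd : nondecreasing_seq c.
  by move=> m n mn; rewrite -subr_ge0 -lecR -sumE// exprn_ge0.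
have c_cvg : cvgn c.
  apply: nondecreasing_is_cvgn => //; exists (complex.Re (`|x| ^+ 2)) => _ [n _ <-].
  rewrite -lecR RRe_real ?ger0_real ?exprn_ge0//.
  by rewrite rmorph_sum (eq_bigr _ (fun k _ => ReE k)) bessel.
have c_le n : c n <= limn c by exact: nondecreasing_cvgn_le.
apply: (@cvg_sq_dist_le _ _ _ (fun n => limn c - c n)) => [|m n].
  by rewrite -(subrr (limn c)); apply: cvgB => //; exact: cvg_cst.
wlog mn : m n / (m <= n)%N.
  move=> le; case/orP: (leq_total m n) => [/le//|/le].
  by rewrite distrC [_ - c n + _]addrC.
rewrite distrC sumE// lecR.
have := c_le n; have := c_le m; lra.
Qed.

Lemma transfer_eq0 x : orthc (range e) x -> transfer e g x = 0.
Proof.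
move=> xe; apply: (lim_near_cst (@norm_hausdorff _ _)); apply: nearW => n.
by rewrite /series/= big1// => k _; rewrite xe ?scale0r//; exists k.
Qed.

Lemma transfer_basis n : transfer e g (e n) = g n.
Proof.
apply: (lim_near_cst (@norm_hausdorff _ _)); near=> m.
have nm : (n < m)%N by near: m; exact: nbhs_infty_gt.
rewrite /series/= (bigD1_seq n) ?mem_index_iota ?iota_uniq//= oe eqxx scale1r.
by rewrite big1 ?addr0// => k kn; rewrite oe eq_sym (negbTE kn) scale0r.
Unshelve. all: by end_near. Qed.

End Transfer.

Lemma transfer_adjoint (e g : nat -> H) : orthonormal_family e -> orthonormal_family g ->
  adjoint (transfer e g) (transfer g e).
Proof.
move=> oe og x y.
have cvgl := cvg_ip (y := y) (transfer_cvg oe og (x := x)).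
have cvgr := cvg_ipr (y := x) (transfer_cvg og oe (x := y)).
apply: (cvg_unique (@norm_hausdorff _ _) cvgl); apply: cvg_trans cvgr.
apply: near_eq_cvg; apply: nearW => n; rewrite /series/= ip_suml.
rewrite [LHS]ipC ip_suml rmorph_sum; apply: eq_bigr => k _.
by rewrite !ipZl rmorphM mulrC (ipC (e k) x) (ipC y (g k)).
Qed.

Definition partial_isometry A B (V W : H -> H) :=
  [/\ adjoint V W, forall x, B (V x), forall y, A (W y),
      forall x, A x -> W (V x) = x & forall y, B y -> V (W y) = y].

Lemma partial_isometry_sym A B V W : partial_isometry A B V W -> partial_isometry B A W V.
Proof. by case=> aV BV AW WV VW; split=> //; exact: adjoint_sym. Qed.

Lemma partial_isometry_eq0 A B V W x :
  partial_isometry A B V W -> orthc A x -> V x = 0.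
Proof. by case=> aV _ AW _ _ Ax; apply: ip_inj => z; rewrite aV ip0l Ax. Qed.

Lemma partial_isometry_transfer (e g : nat -> H) :
  orthonormal_family e -> orthonormal_family g ->
  partial_isometry (cspan e) (cspan g) (transfer e g) (transfer g e).
Proof.
have in_cspan p q x : orthonormal_family p -> orthonormal_family q ->
    cspan q (transfer p q x).
  by move=> op oq z qz; rewrite transfer_adjoint// transfer_eq0// ip0r.
have transferK p q x : orthonormal_family p -> orthonormal_family q ->
    cspan p x -> transfer q p (transfer p q x) = x.
  move=> op oq px; apply/subr0_eq/(@orthc_self_eq0 (orthc (range p))); last first.
    exact: (closed_subspaceB (closed_subspace_orthc _) (in_cspan _ _ _ oq op) px).
  move=> _ [n _ <-]; rewrite ipBl transfer_adjoint// transfer_basis//.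
  by rewrite transfer_adjoint// transfer_basis// subrr.
move=> oe og; split; [exact: transfer_adjoint| | | |].
- by move=> x; exact: in_cspan.
- by move=> x; exact: in_cspan.
- by move=> x; exact: transferK.
- by move=> x; exact: transferK.
Qed.

Lemma exists_partial_isometry A B : separable_space H ->
  closed_subspace A -> infinite_dim A -> closed_subspace B -> infinite_dim B ->
  exists V W, partial_isometry A B V W.
Proof.
move=> sH hA iA hB iB.
have [e [oe <-]] := orthonormal_basis sH hA iA.
have [g [og <-]] := orthonormal_basis sH hB iB.
by exists (transfer e g), (transfer g e); exact: partial_isometry_transfer.
Qed.

(** * Common complements *)

Lemma common_complement_of_retraction S T (F F' : H -> H) : adjoint F F' ->
  (forall x, S (F x)) -> (forall x, S x -> F x = x) ->
  (forall x, T x -> F x = 0 -> x = 0) -> (forall y, S y -> exists2 x, T x & F x = y) ->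
  common_complement S T.
Proof.
move=> aF SF FS injF surjF; exists [set x | F x = 0]; split.
- exact: closed_subspace_ker aF.
- by move=> x [Sx /= Fx]; rewrite -(FS x Sx).
- by move=> x [Tx /= Fx]; apply: injF.
- move=> h; exists (F h), (h - F h); split=> //=; last by rewrite addrC subrK.
  by rewrite (adjoint_opB aF) (FS (F h))// subrr.
- move=> h; have [t Tt Ft] := surjF _ (SF h); exists t, (h - t).
  by split=> //=; [rewrite (adjoint_opB aF) Ft subrr|rewrite addrC subrK].
Qed.

Lemma common_complement_of_image S T (G G' : H -> H) : adjoint G G' -> injective G ->
  common_complement (G @` S) (G @` T) -> common_complement S T.
Proof.
move=> aG injG [Z [hZ SZ TZ SZH TZH]].
have trivial_meet A : G @` A `&` Z `<=` [set 0] -> A `&` (G @^-1` Z) `<=` [set 0].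
  move=> AZ x [Ax Zx]; apply: injG; rewrite (adjoint_op0 aG).
  by apply: AZ; split=> //; exists x.
have decomp A : (forall h, exists a z, [/\ (G @` A) a, Z z & h = a + z]) ->
    forall h, exists a z, [/\ A a, (G @^-1` Z) z & h = a + z].
  move=> AZ h; have [_ [z [[a Aa <-] Zz GhE]]] := AZ (G h); exists a, (h - a).
  by split; rewrite ?[a + _]addrC ?subrK//= (adjoint_opB aG) GhE addrC addKr.
exists (G @^-1` Z); split; [exact: closed_subspace_preimage aG _ hZ| | | |].
- exact: trivial_meet.
- exact: trivial_meet.
- exact: decomp.
- exact: decomp.
Qed.

(* For W vanishing on ker E, this is W on ran E and F on ker E. *)
Definition splice (E W F : H -> H) x := F (x - E x) + W x.

Section CommonComplement.
Variables S T : set H.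
Hypotheses (sH : separable_space H) (hS : closed_subspace S) (hT : closed_subspace T).

Lemma exists_isometric_retraction :
  infinite_dim (orthc S) -> infinite_dim (S `&` orthc T) -> exists F F',
    [/\ adjoint F F', forall x, S (F x), forall x, S x -> F x = x &
        forall t u, T t -> T u -> ip (F t) (F u) = ip t u].
Proof.
move=> iS iST; have [P hP] := proj_exists hS; have aP := proj_adjoint hP.
have hST : closed_subspace (S `&` orthc T) by exact: closed_subspaceI_orthc.
have [J [J' piJ]] := exists_partial_isometry sH (closed_subspace_orthc S) iS hST iST.
have [aJ STJ _ J'J _] := piJ.
have JS x : S x -> J x = 0.
  by move=> Sx; apply: (partial_isometry_eq0 piJ) => a Sa; exact/ip_eq0C/Sa.
exists (fun x => P x + J x), (fun x => P x + J' x); split.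
- exact: adjoint_add.
- by move=> x; apply: closed_subspaceD => //; [exact: proj_in hP x|case: (STJ x)].
- by move=> s Ss; rewrite (proj_id hS hP Ss) JS// addr0.
move=> t u Tt Tu.
have PJ a b : T a -> ip (P a) (J b) = 0.
  by case: (STJ b) => SJ TJ Ta; rewrite aP (proj_id hS hP SJ) ip_eq0C ?TJ.
have JJ : ip (J t) (J u) = ip (t - P t) u.
  rewrite -[J t]subr0 -(JS (P t) (proj_in hP t)) -(adjoint_opB aJ) -(adjoint_sym aJ) J'J//.
  exact: proj_orthc hP t.
rewrite ipDl !ipDr PJ// (ip_eq0C (PJ u t Tu)) addr0 add0r JJ.
by rewrite aP (proj_id hS hP (proj_in hP u)) -aP -ipDl addrC subrK.
Qed.

Section Splice.
Variables (T1 : set H) (F F' E W W' : H -> H).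
Local Notation T0 := (T `&` orthc T1).
Local Notation K := (S `&` orthc (F @` T0)).
Hypotheses (aF : adjoint F F') (SF : forall x, S (F x)) (FS : forall x, S x -> F x = x).
Hypothesis (isoF : forall t u, T t -> T u -> ip (F t) (F u) = ip t u).
Hypotheses (hT1 : closed_subspace T1) (T1T : T1 `<=` T) (T1S : T1 `<=` orthc S).
Hypotheses (hE : proj_onto E T1) (piW : partial_isometry T1 K W W').

Let splice_eq0 x : orthc T1 x -> E x = 0 /\ W x = 0.
Proof.
by move=> T1x; split; [exact: (proj_eq0 hT1 hE)|exact: (partial_isometry_eq0 piW)].
Qed.

Lemma splice_adjoint :
  adjoint (splice E W F) (fun y => (F' y - E (F' y)) + W' y).
Proof.
have aE := proj_adjoint hE; have [aW _ _ _ _] := piW.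
exact: adjoint_add (adjoint_comp aF (adjoint_sub adjoint_id aE)) aW.
Qed.

Lemma splice_in x : S (splice E W F x).
Proof.
by have [_ KW _ _ _] := piW; apply: closed_subspaceD => //; case: (KW x).
Qed.

Lemma splice_id s : S s -> splice E W F s = s.
Proof.
move=> Ss; have [E0 W0] := splice_eq0 (sub_orthcC T1S Ss).
by rewrite /splice E0 W0 subr0 addr0 FS.
Qed.

Lemma splice_inj t : T t -> splice E W F t = 0 -> t = 0.
Proof.
move=> Tt Gt_eq0; have [aW KW _ W'W _] := piW.
have Tu : T (t - E t) by apply: closed_subspaceB => //; exact/T1T/(proj_in hE).
have Wt : W t = - F (t - E t) by apply/eqP; rewrite -addr_eq0 addrC -/(splice E W F t) Gt_eq0.
have Fu0 : F (t - E t) = 0.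
  apply: (@orthc_self_eq0 (F @` T0)).
    by exists (t - E t) => //; split=> //; exact: proj_orthc hE t.
  by rewrite -[F _]opprK -Wt; apply/(closed_subspaceN (closed_subspace_orthc _))/(KW t).2.
have /subr0_eq tE : t - E t = 0 by apply: ip_self_eq0; rewrite -isoF// Fu0 ip0l.
rewrite -(W'W t) ?Wt ?Fu0 ?oppr0 ?(adjoint_op0 (adjoint_sym aW))// tE.
exact: proj_in hE t.
Qed.

Lemma splice_surj s : S s -> exists2 t, T t & splice E W F t = s.
Proof.
move=> Ss; have [_ _ T1W' _ WW'] := piW.
have hT0 : closed_subspace T0 by exact: closed_subspaceI_orthc.
have [E0 hE0] := proj_exists hT0.
have hD : proj_onto (fun y => F (E0 (F' y))) (F @` T0).
  by apply: proj_onto_image => // a b [Ta _] [Tb _]; exact: isoF.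
have [[t0 [Tt0 T1t0] Ft0] FT0k] := hD s; set k := s - _ in FT0k.
have Kk : K k by split=> //; apply: closed_subspaceB => //; exact: SF.
have [Et0 Wt0] := splice_eq0 T1t0.
exists (t0 + W' k); first by apply: closed_subspaceD => //; exact/T1T/T1W'.
rewrite (adjoint_opD splice_adjoint) /splice Et0 Wt0 (proj_id hT1 hE (T1W' k)).
by rewrite subrr (adjoint_op0 aF) WW'// subr0 addr0 add0r Ft0 addrC subrK.
Qed.

End Splice.

Lemma common_complement_of_orthogonal_parts :
  infinite_dim (S `&` orthc T) -> infinite_dim (T `&` orthc S) -> common_complement S T.
Proof.
move=> iST iTS; pose T1 := T `&` orthc S.
have iS := infinite_dimS (@subIsetr _ T (orthc S)) iTS.
have [F [F' [aF SF FS isoF]]] := exists_isometric_retraction iS iST.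
pose K := S `&` orthc (F @` (T `&` orthc T1)).
have hT1 : closed_subspace T1 by exact: closed_subspaceI_orthc.
have hK : closed_subspace K by exact: closed_subspaceI_orthc.
have iK : infinite_dim K.
  apply: (infinite_dim_image aF hT1) iTS => t1 [Tt1 St1].
    split=> // _ [t0 [Tt0 T1t0] <-]; rewrite isoF//; exact/ip_eq0C/T1t0.
  by move=> Ft1; apply: ip_self_eq0; rewrite -isoF// Ft1 ip0l.
have [E hE] := proj_exists hT1.
have [W [W' piW]] := exists_partial_isometry sH hT1 iTS hK iK.
apply: (common_complement_of_retraction (splice_adjoint aF hE piW)).
- by move=> x; exact: splice_in SF piW x.
- by move=> s; apply: (splice_id FS hT1 (@subIsetr _ _ _) hE piW).
- by move=> t; apply: (splice_inj isoF (@subIsetl _ _ _) hE piW).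
- by move=> s; apply: (splice_surj aF SF isoF hT1 (@subIsetl _ _ _) hE piW).
Qed.

End CommonComplement.

(** * Rotations and shears *)

Definition unitary (U U' : H -> H) := [/\ adjoint U U', cancel U U' & cancel U' U].

Lemma closed_subspace_can_image A G G' G'' : cancel G G' -> cancel G' G -> adjoint G' G'' ->
  closed_subspace A -> closed_subspace (G @` A).
Proof.
move=> GK G'K aG' hA; suff -> : G @` A = G' @^-1` A by exact: closed_subspace_preimage aG' _ hA.
by apply/seteqP; split=> [_ [x Ax <-]|x Ax]; [rewrite /= GK|exists (G' x)].
Qed.

Section UnitaryConjugation.
Variables (U U' P : H -> H) (A : set H).
Hypotheses (uU : unitary U U') (hA : closed_subspace A) (hP : proj_onto P A).

Lemma ip_unitary x y : ip (U x) (U y) = ip x y.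
Proof. by case: uU => aU UK _; rewrite aU UK. Qed.

Lemma norm_unitary x : `|U x| = `|x|.
Proof. by apply/eqP; rewrite -(@eqrXn2 _ 2)// -!ip_norm ip_unitary. Qed.

Lemma closed_subspace_unitary : closed_subspace (U @` A).
Proof.
by case: uU => aU UK U'K; exact: closed_subspace_can_image UK U'K (adjoint_sym aU) hA.
Qed.

Lemma proj_onto_unitary : proj_onto (fun x => U (P (U' x))) (U @` A).
Proof. by case: uU => aU _ _; apply: proj_onto_image => // a b _ _; exact: ip_unitary. Qed.

Lemma orth_proj_unitary : orth_proj ip (fun x => U (P (U' x))).
Proof. exact: proj_onto_orth_proj closed_subspace_unitary proj_onto_unitary. Qed.

Lemma range_proj_unitary : range (fun x => U (P (U' x))) = U @` A.
Proof. exact: range_proj closed_subspace_unitary proj_onto_unitary. Qed.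

Lemma proj_inf_inf_unitary : infinite_dim A -> infinite_dim (orthc A) ->
  proj_inf_inf ip (fun x => U (P (U' x))).
Proof.
move=> iA jA; have [aU UK _] := uU; have U0 x : U x = 0 -> x = 0.
  by rewrite -{2}(UK x) => ->; rewrite (adjoint_op0 (adjoint_sym aU)).
split; [exact: orth_proj_unitary|rewrite range_proj_unitary|].
  by apply: (infinite_dim_image aU hA) iA => x Ax; [exists x|exact: U0].
rewrite (nullspace_proj closed_subspace_unitary proj_onto_unitary).
apply: (infinite_dim_image aU (closed_subspace_orthc A)) jA => x Ax; last exact: U0.
by move=> _ [a Aa <-]; rewrite ip_unitary Ax.
Qed.

Lemma unitary_conj_near (d : C) : 0 <= d -> (forall x, `|U x - x| <= d * `|x|) ->
  forall x, `|P x - U (P (U' x))| <= 2 * d * `|x|.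
Proof.
move=> d0 Ud x; have [aU _ U'K] := uU; have aP := proj_adjoint hP.
have -> : P x - U (P (U' x)) = (P x - U (P x)) + U (P (x - U' x)).
  by rewrite (adjoint_opB aP) (adjoint_opB aU) addrA subrK.
apply: le_trans (ler_normD _ _) _; rewrite mulr_natl mulr2n mulrDl lerD//.
  rewrite distrC; apply: le_trans (Ud _) _; rewrite ler_wpM2l//.
  exact: norm_proj_le hP x.
rewrite norm_unitary; apply: le_trans (norm_proj_le hP _) _.
by rewrite -norm_unitary (adjoint_opB aU) U'K Ud.
Qed.

End UnitaryConjugation.

(* Rodrigues' formula: exp (t N) if N^3 = - N, c = cos t and s = sin t. *)
Definition rodrigues (c s : R) (N : H -> H) x :=
  x + (s%:C%C *: N x + (1 - c)%:C%C *: N (N x)).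

Section Rodrigues.
Variables (c s : R) (N : H -> H).
Hypotheses (cs1 : c ^+ 2 + s ^+ 2 = 1) (aN : adjoint N (fun x => - N x)).
Hypothesis (NNN : forall x, N (N (N x)) = - N x).

Lemma norm_skew_cube_le x : `|N x| <= `|x|.
Proof.
have ipNN y : ip (N y) (N y) = - ip y (N (N y)) by rewrite aN ipNr.
have NN : `|N (N x)| = `|N x|.
  apply/eqP; rewrite -(@eqrXn2 _ 2)// -!ip_norm; apply/eqP.
  by rewrite ipNN NNN ipNr opprK aN ipNr -ipNN.
have [->|Nx0] := eqVneq (N x) 0; first by rewrite normr0.
have sqN : `|N x| * `|N x| = `|ip x (N (N x))|.
  by rewrite -[RHS]normrN -ipNN ip_norm ger0_norm ?exprn_ge0.
by rewrite -(@ler_pM2r _ `|N x|) ?normr_gt0// -[in leRHS]NN sqN cauchy_schwarz.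
Qed.

Lemma rodrigues_adjoint : adjoint (rodrigues c s N) (rodrigues c (- s) N).
Proof.
move=> x y.
have aR := adjoint_add adjoint_id
  (adjoint_add (adjoint_scale s aN) (adjoint_scale (1 - c) (adjoint_comp aN aN))).
rewrite aR /rodrigues scalerN rmorphN scaleNr; congr (ip x (_ + (_ + _ *: _))).
by rewrite (adjoint_opN aN) opprK.
Qed.

Lemma rodriguesK x : rodrigues c s N (rodrigues c (- s) N x) = x.
Proof.
pose comb (a b d : R) := a%:C%C *: x + (b%:C%C *: N x + d%:C%C *: N (N x)).
have combD a b d a' b' d' : comb a b d + comb a' b' d' = comb (a + a') (b + b') (d + d').
  by rewrite /comb !rmorphD !scalerDl addrACA; congr (_ + _); rewrite addrACA.
have combZ k a b d : k%:C%C *: comb a b d = comb (k * a) (k * b) (k * d).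
  by rewrite /comb !scalerDr !scalerA -!rmorphM.
have N_comb a b d : N (comb a b d) = comb 0 (a - d) b.
  rewrite /comb !(adjoint_opD aN) !(adjoint_opZ aN) NNN scale0r add0r.
  by rewrite addrCA scalerN -scaleNr rmorphB scalerBl scaleNr addrC -addrA.
have -> : rodrigues c (- s) N x = comb 1 (- s) (1 - c) by rewrite /comb scale1r.
rewrite /rodrigues !N_comb !combZ !combD; transitivity (comb 1 0 0).
  congr comb; [ring|ring|by rewrite -[RHS](subrr 1) -[X in _ = _ - X]cs1; ring].
by rewrite /comb scale1r !scale0r !addr0.
Qed.

Lemma rodrigues_near x : `|rodrigues c s N x - x| <= (`|s| + `|1 - c|)%:C%C * `|x|.
Proof.
rewrite /rodrigues addrC addKr; apply: le_trans (ler_normD _ _) _.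
have Nx := norm_skew_cube_le x; have NNx := le_trans (norm_skew_cube_le (N x)) Nx.
by rewrite !normrZ !norm_real_complex rmorphD mulrDl lerD ?ler_wpM2l ?ler0c.
Qed.

End Rodrigues.

Definition rotation (c s : R) (V W : H -> H) := rodrigues c s (fun x => V x - W x).

Section Rotation.
Variables (A B : set H) (V W : H -> H) (c s : R).
Hypotheses (piV : partial_isometry A B V W) (BA : B `<=` orthc A).
Hypothesis (cs1 : c ^+ 2 + s ^+ 2 = 1).

Let piW : partial_isometry B A W V.
Proof. exact: partial_isometry_sym. Qed.

Let VB x : B x -> V x = 0.
Proof. by move=> /BA; exact: (partial_isometry_eq0 piV). Qed.

Let WA x : A x -> W x = 0.
Proof. by move=> Ax; apply: (partial_isometry_eq0 piW); exact: (sub_orthcC BA Ax). Qed.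

Let N x := V x - W x.

Let aN : adjoint N (fun x => - N x).
Proof.
have [aV _ _ _ _] := piV; move=> x y; rewrite /N opprB.
exact: adjoint_sub aV (adjoint_sym aV) x y.
Qed.

Let NNN x : N (N (N x)) = - N x.
Proof.
have [aV BV AW WV VW] := piV; have aW := adjoint_sym aV.
have NV y : N (V y) = - W (V y) by rewrite /N (VB (BV y)) sub0r.
have NW y : N (W y) = V (W y) by rewrite /N (WA (AW y)) subr0.
have -> : N (N x) = - (W (V x) + V (W x)).
  by rewrite {2}/N (adjoint_opB aN) NV NW opprD.
by rewrite (adjoint_opN aN) (adjoint_opD aN) NV NW (VW _ (BV x)) (WV _ (AW x)).
Qed.

Lemma rotation_unitary : unitary (rotation c s V W) (rotation c (- s) V W).
Proof.
split; first exact: rodrigues_adjoint.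
  have cs1' : c ^+ 2 + (- s) ^+ 2 = 1 by rewrite sqrrN.
  by move=> x; have := rodriguesK cs1' aN NNN x; rewrite opprK.
by move=> x; exact: rodriguesK.
Qed.

Lemma rotation_near x : `|rotation c s V W x - x| <= (`|s| + `|1 - c|)%:C%C * `|x|.
Proof. exact: rodrigues_near. Qed.

Lemma rotation_in x : A x -> rotation c s V W x = c%:C%C *: x + s%:C%C *: V x.
Proof.
have [_ BV _ WV _] := piV; move=> Ax.
have Nx : N x = V x by rewrite /N (WA Ax) subr0.
have NVx : N (V x) = - x by rewrite /N (VB (BV x)) sub0r WV.
rewrite /rotation -/N /rodrigues Nx NVx scalerN addrCA.
by rewrite -{2}[x]scale1r -scalerBl rmorphB rmorph1 subKr addrC.
Qed.

Lemma rotation_fix x : orthc A x -> orthc B x -> rotation c s V W x = x.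
Proof.
move=> Ax Bx; have Nx : N x = 0.
  by rewrite /N (partial_isometry_eq0 piV Ax) (partial_isometry_eq0 piW Bx) subr0.
by rewrite /rotation -/N /rodrigues Nx (adjoint_op0 aN) !scaler0 !addr0.
Qed.

End Rotation.

Definition shear (r : R) (F : H -> H) x := x + r%:C%C *: F x.

Section Shear.
Variables (F F' : H -> H).
Hypotheses (aF : adjoint F F') (FF : forall x, F (F x) = 0).

Lemma shear_adjoint r : adjoint (shear r F) (shear r F').
Proof. exact: adjoint_add adjoint_id (adjoint_scale r aF). Qed.

Lemma shearK r : cancel (shear r F) (shear (- r) F).
Proof.
move=> x; rewrite /shear (adjoint_opD aF) (adjoint_opZ aF) FF scaler0 addr0.
by rewrite rmorphN scaleNr addrK.
Qed.

Lemma closed_subspace_shear r A : closed_subspace A -> closed_subspace (shear r F @` A).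
Proof.
apply: (closed_subspace_can_image (shearK r) _ (shear_adjoint (- r))).
by have := shearK (- r); rewrite opprK.
Qed.

End Shear.

(** * Density *)

(* [rotation c s V W] turns A, inside S, towards B, inside the orthogonal complement of T. *)
Definition tilting S T A B V W :=
  [/\ partial_isometry A B V W, A `<=` S, B `<=` orthc T, B `<=` orthc A & infinite_dim B].

Section ShearedRotation.
Variables (S T A1 B1 A2 B2 : set H) (V1 W1 V2 W2 : H -> H) (c s : R).
Hypotheses (tilt1 : tilting S T A1 B1 V1 W1) (tilt2 : tilting T S A2 B2 V2 W2).
Hypotheses (B1B2 : B1 `<=` orthc B2) (cs1 : c ^+ 2 + s ^+ 2 = 1) (s0 : s != 0).
Local Notation W := (fun x => W1 x + W2 x).
Local Notation S' := (rotation c s V1 W1 @` S).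

Lemma sum_partial_isometries_adjoint : adjoint W (fun x => V1 x + V2 x).
Proof.
have [[aV1 _ _ _ _] _ _ _ _] := tilt1; have [[aV2 _ _ _ _] _ _ _ _] := tilt2.
exact: adjoint_add (adjoint_sym aV1) (adjoint_sym aV2).
Qed.

Lemma sum_partial_isometries_square0 x : W (W x) = 0.
Proof.
have [pi1 A1S B1T B1A1 _] := tilt1; have [pi2 A2T B2S B2A2 _] := tilt2.
have [[_ _ A1W _ _] [_ _ A2W _ _]] := (pi1, pi2).
have in_orthc B : B `<=` orthc A1 -> B `<=` orthc A2 -> orthc B (W x).
  move=> BA1 BA2; apply: (closed_subspaceD (closed_subspace_orthc B)).
    exact: (sub_orthcC BA1 (A1W x)).
  exact: (sub_orthcC BA2 (A2W x)).
have B1A2 : B1 `<=` orthc A2 by move=> y /B1T; exact: (orthcS A2T).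
have B2A1 : B2 `<=` orthc A1 by move=> y /B2S; exact: (orthcS A1S).
rewrite (partial_isometry_eq0 (partial_isometry_sym pi1) (in_orthc _ B1A1 B1A2)).
by rewrite (partial_isometry_eq0 (partial_isometry_sym pi2) (in_orthc _ B2A1 B2A2)) addr0.
Qed.

Lemma sub_sheared_rotation : closed_subspace S -> B1 `<=` shear (- (c / s)) W @` S'.
Proof.
move=> hS y B1y; have [pi1 A1S _ B1A1 _] := tilt1; have [pi2 _ _ _ _] := tilt2.
have [aV1 _ A1W _ VW1] := pi1; have [aR _ _] := rotation_unitary pi1 B1A1 cs1.
have W2y : W2 y = 0 by apply: (partial_isometry_eq0 (partial_isometry_sym pi2)); exact: B1B2.
exists (shear (c / s) W y); last first.
  exact: (shearK sum_partial_isometries_adjoint sum_partial_isometries_square0).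
exists ((s^-1)%:C%C *: W1 y); first by apply: closed_subspaceZ => //; exact/A1S.
rewrite (adjoint_opZ aR) (rotation_in c s pi1 B1A1 (A1W y)) VW1// scalerDr !scalerA -!rmorphM.
by rewrite mulVf// scale1r /shear W2y addr0 addrC [c / s]mulrC.
Qed.

Lemma sheared_rotation_orthc : B2 `<=` orthc (shear (- (c / s)) W @` S').
Proof.
move=> y B2y _ [_ [x Sx <-] <-]; apply: ip_eq0C.
have [pi1 A1S _ B1A1 _] := tilt1; have [pi2 _ B2S B2A2 _] := tilt2.
have A1y : orthc A1 y by exact: (orthcS A1S (B2S _ B2y)).
have [aR _ _] := rotation_unitary pi1 B1A1 cs1.
rewrite (shear_adjoint sum_partial_isometries_adjoint) /shear (partial_isometry_eq0 pi1 A1y).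
rewrite (partial_isometry_eq0 pi2 (B2A2 _ B2y)) addr0 scaler0 addr0 aR.
by rewrite (rotation_fix c _ pi1 A1y (sub_orthcC B1B2 B2y)) (ip_eq0C (B2S _ B2y _ Sx)).
Qed.

End ShearedRotation.

Section Density.
Variables S T : set H.
Hypotheses (sH : separable_space H) (hS : closed_subspace S) (hT : closed_subspace T).

Lemma common_complement_rotations A1 B1 V1 W1 A2 B2 V2 W2 (c s : R) :
  tilting S T A1 B1 V1 W1 -> tilting T S A2 B2 V2 W2 -> B1 `<=` orthc B2 ->
  c ^+ 2 + s ^+ 2 = 1 -> s != 0 ->
  common_complement (rotation c s V1 W1 @` S) (rotation c s V2 W2 @` T).
Proof.
move=> tilt1 tilt2 B1B2 cs1 s0; have B2B1 := sub_orthcC B1B2.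
have [pi1 _ _ B1A1 iB1] := tilt1; have [pi2 _ _ B2A2 iB2] := tilt2.
pose W x := W1 x + W2 x.
have WC : W = (fun x => W2 x + W1 x) by apply/funext => x; exact: addrC.
have aW := sum_partial_isometries_adjoint tilt1 tilt2.
have WW := sum_partial_isometries_square0 tilt1 tilt2.
have closed_sheared U U' A : unitary U U' -> closed_subspace A ->
    closed_subspace (shear (- (c / s)) W @` (U @` A)).
  by move=> uU hA; apply/(closed_subspace_shear aW WW)/(closed_subspace_unitary uU).
apply: (common_complement_of_image (shear_adjoint aW (- (c / s)))).
  exact: can_inj (shearK aW WW _).
apply: common_complement_of_orthogonal_parts => //.
- exact: closed_sheared (rotation_unitary pi1 B1A1 cs1) hS.
- exact: closed_sheared (rotation_unitary pi2 B2A2 cs1) hT.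
- apply: infinite_dimS iB1 => y B1y; split; first exact: (sub_sheared_rotation tilt1 tilt2).
  by rewrite -/W WC; apply: (sheared_rotation_orthc tilt2 tilt1).
- apply: infinite_dimS iB2 => y B2y; split; last exact: (sheared_rotation_orthc tilt1 tilt2).
  by rewrite -/W WC; apply: (sub_sheared_rotation tilt2 tilt1).
Qed.

Hypotheses (iS : infinite_dim S) (jS : infinite_dim (orthc S)).
Hypotheses (iT : infinite_dim T) (jT : infinite_dim (orthc T)).

Lemma exists_orthogonal_tiltings : exists A1 B1 V1 W1 A2 B2 V2 W2,
  [/\ tilting S T A1 B1 V1 W1, tilting T S A2 B2 V2 W2 & B1 `<=` orthc B2].
Proof.
pose Z (b p : bool) := if p then orthc (if b then T else S) else if b then T else S.
have hZ b p : closed_subspace (Z b p).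
  by case: p; [exact: closed_subspace_orthc|case: b].
have iZ b p : infinite_dim (Z b p) by case: p; case: b.
have iH : infinite_dim [set: H] by exact: infinite_dimS iS.
have [//|//|u [ou Zu]] :=
  @orthonormal_selection (bool * bool * nat)%type (fun i => Z i.1.1 i.1.2) iH.
pose e b p n := u (b, p, n).
have oe b p : orthonormal_family (e b p) by move=> m n; rewrite ou xpair_eqE eqxx.
have orth b p b' p' : (b, p) != (b', p') -> cspan (e b p) `<=` orthc (cspan (e b' p')).
  by move=> bp; apply: cspan_orthc => m n; rewrite ou xpair_eqE (negbTE bp).
have sub b p : cspan (e b p) `<=` Z b p by apply: cspan_sub => // n; exact: Zu.
have tilt b : tilting (Z b false) (Z (~~ b) false) (cspan (e b false)) (cspan (e (~~ b) true))
    (transfer (e b false) (e (~~ b) true)) (transfer (e (~~ b) true) (e b false)).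
  split; [exact: partial_isometry_transfer|exact: sub|exact: (sub (~~ b) true)| |].
    by apply: orth; case: b.
  exact: infinite_dim_cspan.
exists (cspan (e false false)), (cspan (e true true)).
exists (transfer (e false false) (e true true)), (transfer (e true true) (e false false)).
exists (cspan (e true false)), (cspan (e false true)).
exists (transfer (e true false) (e false true)), (transfer (e false true) (e true false)).
by split; [exact: (tilt false)|exact: (tilt true)|exact: orth].
Qed.

Lemma common_complement_dense (e : R) : 0 < e -> exists U1 U1' U2 U2',
  [/\ unitary U1 U1', unitary U2 U2', forall x, `|U1 x - x| <= e%:C%C * `|x|,
      forall x, `|U2 x - x| <= e%:C%C * `|x| & common_complement (U1 @` S) (U2 @` T)].
Proof.
move=> e0; have [c [s [cs1 s0 cse]]] := exists_small_angle e0.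
have [A1 [B1 [V1 [W1 [A2 [B2 [V2 [W2 [tilt1 tilt2 B1B2]]]]]]]]] := exists_orthogonal_tiltings.
have [pi1 _ _ B1A1 _] := tilt1; have [pi2 _ _ B2A2 _] := tilt2.
have near A B V W x : partial_isometry A B V W -> B `<=` orthc A ->
    `|rotation c s V W x - x| <= e%:C%C * `|x|.
  move=> piV BA; apply: le_trans (rotation_near c s piV BA x) _.
  by rewrite ler_wpM2r// lecR ltW.
exists (rotation c s V1 W1), (rotation c (- s) V1 W1).
exists (rotation c s V2 W2), (rotation c (- s) V2 W2); split.
- exact: (rotation_unitary pi1 B1A1 cs1).
- exact: (rotation_unitary pi2 B2A2 cs1).
- by move=> x; exact: near pi1 B1A1.
- by move=> x; exact: near pi2 B2A2.
- exact: (common_complement_rotations tilt1 tilt2).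
Qed.

End Density.

End Hilbert.

Theorem mainTheorem4 (R : realType) (H : completeNormedModType R[i])
    (ip : H -> H -> R[i]) :
  inner_product ip -> separable_space H -> infinite_dim [set: H] ->
  forall P Q : H -> H, proj_inf_inf ip P -> proj_inf_inf ip Q ->
  forall e : R[i], 0 < e ->
  exists P' Q' : H -> H,
    [/\ proj_inf_inf ip P', proj_inf_inf ip Q', in_Delta ip P' Q',
        opnorm_lt (fun x => P x - P' x) e
      & opnorm_lt (fun x => Q x - Q' x) e].
Proof.
move=> hip sH _ P Q [oP iP jP] [oQ iQ jQ] e e0.
have [hS hP] := orth_proj_onto hip oP; have [hT hQ] := orth_proj_onto hip oQ.
rewrite (nullspace_proj hip hS hP) in jP; rewrite (nullspace_proj hip hT hQ) in jQ.
have /complex_realP[d dE] : e / 4 \is Num.real by rewrite gtr0_real// divr_gt0.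
have d0 : 0 < d by rewrite -ltcR -dE divr_gt0.
have de : 2 * d%:C%C < e.
  have -> : 2 * d%:C%C = e / 2 by rewrite -dE; field.
  by rewrite ltr_pdivrMr// ltr_pMr// ltr1n.
have [U [U' [V [V' [uU uV nearU nearV ccUV]]]]] :=
  common_complement_dense hip sH hS hT iP jP iQ jQ d0.
exists (fun x => U (P (U' x))), (fun x => V (Q (V' x))); split.
- exact: (proj_inf_inf_unitary hip uU hS hP).
- exact: (proj_inf_inf_unitary hip uV hT hQ).
- split; [exact: (orth_proj_unitary hip uU hS hP)|exact: (orth_proj_unitary hip uV hT hQ)|].
  by rewrite (range_proj_unitary hip uU hS hP) (range_proj_unitary hip uV hT hQ).
- by exists (2 * d%:C%C); split=> //; apply: (unitary_conj_near hip uU hP); rewrite ?ler0c ?ltW.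
- by exists (2 * d%:C%C); split=> //; apply: (unitary_conj_near hip uV hQ); rewrite ?ler0c ?ltW.
Qed.
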